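(* The Shapley-Tijs value on $\mathcal{HE}^*$, i.e. the map $(\Gamma,P)\mapsto\Lambda(N,c,P)$ where $(N,c,P)$ is the game with a coalitional structure associated to $(\Gamma,P)$, satisfies (PO), (ETPU), (CIOC), (PSSA) and (CPEA), and it is the unique solution on $\mathcal{HE}^*$ satisfying these five properties.
   Context: A generalized highway problem is a 4-tuple $\Gamma=(N,K,C,T)$ where $N$ is a finite set of agents, $K$ is a finite nonempty ordered set of sections, $C:K\to\mathbb{R}_+$ gives the cost of each section, and $T:N\to 2^K\setminus\{\emptyset\}$ gives the set of sections used by each agent, with $\bigcup_{i\in N}T(i)=K$. For $S\subseteq N$ put $T(S)=\bigcup_{i\in S}T(i)$, and for $K'\subseteq K$ put $C(K')=\sum_{t\in K'}C(t)$. The associated cost game is $(N,c)$ with $c(S)=C(T(S))$. If $P=\{P_1,\dots,P_A\}$ is a partition of $N$ (into nonempty a priori unions), $(\Gamma,P)$ is a generalized highway problem with a coalitional structure and $(N,c,P)$ its associated game; put $M=\{1,\dots,A\}$, each index $a$ being identified with the set $P_a$. $\mathcal{HE}^*$ is the set of all generalized highway problems with a coalitional structure (agent set and section set vary). A solution (value) $\sigma$ on $\mathcal{HE}^*$ assigns to each $(\Gamma,P)\in\mathcal{HE}^*$ a vector $(\sigma_i(\Gamma,P))_{i\in N}\in\mathbb{R}^N$; by convention $\sigma_j(\Gamma,P)=0$ for $j\notin N$. Restriction: for $\emptyset\neq K'\subseteq K$, $\Gamma|_{K'}=(N|_{K'},K',C|_{K'},T^{K'})$ with $N|_{K'}=\{i\in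 N\mid T(i)\cap K'\neq\emptyset\}$, $T^{K'}(i)=T(i)\cap K'$ (and $K'$ with the induced order); $P|_{K'}=\{P_a\cap N|_{K'}\mid P_a\in P,\ T(P_a)\cap K'\neq\emptyset\}$. Exclusive/shared sections: $N_t=\{j\in N\mid t\in T(j)\}$, $K^e=\{t\in K\mid|N_t|=1\}$, $K^s=K\setminus K^e$, $T^e(i)=T(i)\cap K^e$, $T^s(i)=T(i)\cap K^s$, $T^e(S)=\bigcup_{i\in S}T^e(i)$, $c^e(i)=C(T^e(i))$, $c^s(i)=C(T^s(i))$, $c^e(a)=\sum_{j\in P_a}c^e(j)$. Owen value: for $i\in P_a$, $$\Psi_i(N,c,P)=\sum_{H\subseteq M\setminus\{a\}}\ \sum_{S\subseteq P_a\setminus\{i\}}\frac{1}{|P_a|\cdot A}\cdot\frac{1}{\binom{A-1}{|H|}\binom{|P_a|-1}{|S|}}\bigl(c(R\cup S\cup\{i\})-c(R\cup S)\bigr),\qquad R=\bigcup_{b\in H}P_b,$$ and $\Psi_a(N,c,P)=\sum_{i\in P_a}\Psi_i(N,c,P)$. Shapley-Tijs value: for $i\in P_a$, $$\Lambda_i(N,c,P)=\begin{cases}c^e(i)&\text{if }K^s=\emptyset,\\ c^e(i)+\bigl(\Psi_a(N,c,P)-c^e(a)\bigr)\cdot\dfrac{c^s(i)}{\sum_{j\in P_a}c^s(j)}&\text{if }K^s\neq\emptyset,\end{cases}$$ where a fraction $0/0$ is read as $0$. Properties of a solution $\sigma$ ($\mathbb{R}_+$ is the set of nonnegative reals): - (PO)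 For all $(\Gamma,P)\in\mathcal{HE}^*$, $\sum_{i\in N}\sigma_i(\Gamma,P)=C(K)$. - (ETPU) For all $(\Gamma,P)\in\mathcal{HE}^*$ and $P_a,P_{a'}\in P$: $T(P_a)=T(P_{a'})$ implies $\sum_{i\in P_a}\sigma_i(\Gamma,P)=\sum_{i\in P_{a'}}\sigma_i(\Gamma,P)$. - (CIOC) For all $(\Gamma,P),(\Gamma',P')\in\mathcal{HE}^*$ with $\Gamma=(N,K,C,T)$, $\Gamma'=(N',K',C',T')$, and every common union $P_a\in P\cap P'$: if $\Gamma|_{T(P_a)}=\Gamma'|_{T'(P_a)}$ and $P|_{T(P_a)}=P'|_{T'(P_a)}$, then $\sum_{i\in P_a}\sigma_i(\Gamma,P)=\sum_{i\in P_a}\sigma_i(\Gamma',P')$. - (PSSA) For all $(\Gamma,P)\in\mathcal{HE}^*$ and $a\in M$ with $T^e(P_a)=\emptyset$, there exists $\mathfrak{c}_a\in\mathbb{R}_+$ such that $\sigma_i(\Gamma,P)=\mathfrak{c}_a\cdot c^s(i)$ for all $i\in P_a$. - (CPEA) For all $(\Gamma,P),(\Gamma',P')\in\mathcal{HE}^*$ with $\Gamma=(N,K,C,T)$, $\Gamma'=(N',K',C',T')$: if $i\in N'$, $K'=K\cup\{t\}$ with $t\notin K$, $\Gamma=\Gamma'|_K$, $P=P'|_K$, and $\{j\in N'\mid t\in T'(j)\}=\{i\}$, then $\sigma_i(\Gamma',P')=\sigma_i(\Gamma,P)+C'(t)$ and $\sigma_j(\Gamma',P')=\sigma_j(\Gamma,P)$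 for all $j\in N'\setminus\{i\}$. *)

(* Defs.v *)
From HB Require Import structures.
From mathcomp Require Import all_boot all_order all_algebra finmap reals.

Set Implicit Arguments.
Unset Strict Implicit.
Unset Printing Implicit Defensive.

Import Order.TTheory GRing.Theory Num.Theory.

Local Open Scope fset_scope.
Local Open Scope ring_scope.

Section HighwayProblems.
Context {R : realType} {U V : choiceType}.

(* The quadruple (N, K, C, T), with agents taken in U and sections in V.
   The ordered set K is the list of its elements in increasing order; C and T
   are finite maps with domains K and N, so that Leibniz equality of two
   quadruples is equality as mathematical objects. *)
Record highway := Highway {
  agents : {fset U};
  sections : seq V;
  cost : {fmap V -> R};
  usage : {fmap U -> {fset V}} }.

Implicit Types (g : highway) (P : {fset {fset U}}) (S B : {fset U}).

Definition secset g : {fset V} := [fset t in sections g].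

Definition C_ g (t : V) : R := odflt 0 (cost g).[? t]%fmap.

Definition T_ g (i : U) : {fset V} := odflt fset0 (usage g).[? i]%fmap.

Definition TS g S : {fset V} := \bigcup_(i <- S) T_ g i.

Definition CS g (K' : {fset V}) : R := \sum_(t <- K') C_ g t.

Definition highway_wf g : bool :=
  [&& uniq (sections g), sections g != [::],
      domf (cost g) == secset g, domf (usage g) == agents g,
      all (fun t => 0 <= C_ g t) (secset g),
      all (fun i => (T_ g i != fset0) && (T_ g i `<=` secset g)) (agents g)
    & TS g (agents g) == secset g].

Definition is_partition P (N : {fset U}) : bool :=
  [&& fset0 \notin P, trivIfset P & fcover P == N].

(* The set HE^*. An a priori union P_a is referred to by the set itself rather
   than by its index a. *)
Record HE := MkHE {
  problem :> highway;
  unions : {fset {fset U}};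
  problem_wf : highway_wf problem;
  unions_wf : is_partition unions (agents problem) }.

Definition cost_game g S : R := CS g (TS g S).

Definition restr_agents g (K' : {fset V}) : {fset U} :=
  [fset i in agents g | T_ g i `&` K' != fset0].

Definition restr g (K' : {fset V}) : highway :=
  {| agents := restr_agents g K';
     sections := [seq t <- sections g | t \in K'];
     cost := (cost g).[& K']%fmap;
     usage := [fmap i : restr_agents g K' => T_ g (val i) `&` K']%fmap |}.

Definition restr_unions g P (K' : {fset V}) : {fset {fset U}} :=
  [fset B `&` restr_agents g K' | B in P & TS g B `&` K' != fset0].

Definition users g (t : V) : {fset U} := [fset j in agents g | t \in T_ g j].

Definition excl_secs g : {fset V} :=
  [fset t in secset g | #|` users g t| == 1%N].

Definition shared_secs g : {fset V} := secset g `\` excl_secs g.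

Definition Te g (i : U) : {fset V} := T_ g i `&` excl_secs g.

Definition Ts g (i : U) : {fset V} := T_ g i `&` shared_secs g.

Definition TeS g S : {fset V} := \bigcup_(i <- S) Te g i.

Definition ce g (i : U) : R := CS g (Te g i).

Definition cs g (i : U) : R := CS g (Ts g i).

Definition ceS g S : R := \sum_(j <- S) ce g j.

(* When P is a partition and i an agent, the only union containing i. *)
Definition union_of P (i : U) : {fset U} := \bigcup_(B <- P | i \in B) B.

Definition owen (c : {fset U} -> R) P (i : U) : R :=
  let Pa := union_of P i in
  \sum_(H <- fpowerset (P `\ Pa))
    \sum_(S <- fpowerset (Pa `\ i))
      (#|` Pa| * #|` P|)%:R^-1
      * ('C(#|` P|.-1, #|` H|) * 'C(#|` Pa|.-1, #|` S|))%:R^-1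
      * (c (fcover H `|` S `|` [fset i]) - c (fcover H `|` S)).

Definition owen_union (c : {fset U} -> R) P B : R := \sum_(i <- B) owen c P i.

(* Division by 0 yields 0 in a field of MathComp, which gives 0 / 0 = 0. *)
Definition shapley_tijs_at (g : HE) (i : U) : R :=
  let Pa := union_of (unions g) i in
  if shared_secs g == fset0 then ce g i
  else ce g i + (owen_union (cost_game g) (unions g) Pa - ceS g Pa)
                * (cs g i / \sum_(j <- Pa) cs g j).

Definition solution := forall g : HE, {ffun agents g -> R}.

Implicit Type sigma : solution.

(* The component of sigma for i, equal to 0 when i is not an agent. *)
Definition at_ sigma (g : HE) (i : U) : R :=
  if insub i is Some j then sigma g j else 0.

Definition shapley_tijs : solution :=
  fun g : HE => [ffun i : agents g => shapley_tijs_at g (val i)].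

Definition PO sigma : Prop :=
  forall g : HE, \sum_(i <- agents g) at_ sigma g i = CS g (secset g).

Definition ETPU sigma : Prop :=
  forall (g : HE) (B B' : {fset U}), B \in unions g -> B' \in unions g ->
    TS g B = TS g B' ->
    \sum_(i <- B) at_ sigma g i = \sum_(i <- B') at_ sigma g i.

Definition CIOC sigma : Prop :=
  forall (g g' : HE) (B : {fset U}), B \in unions g -> B \in unions g' ->
    restr g (TS g B) = restr g' (TS g' B) ->
    restr_unions g (unions g) (TS g B)
      = restr_unions g' (unions g') (TS g' B) ->
    \sum_(i <- B) at_ sigma g i = \sum_(i <- B) at_ sigma g' i.

Definition PSSA sigma : Prop :=
  forall (g : HE) (B : {fset U}), B \in unions g -> TeS g B = fset0 ->
    exists2 k : R, 0 <= k & forall i, i \in B -> at_ sigma g i = k * cs g i.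

Definition CPEA sigma : Prop :=
  forall (g g' : HE) (i : U) (t : V),
    i \in agents g' -> t \notin secset g -> secset g' = t |` secset g ->
    problem g = restr g' (secset g) ->
    unions g = restr_unions g' (unions g') (secset g) ->
    users g' t = [fset i] ->
    at_ sigma g' i = at_ sigma g i + C_ g' t
    /\ forall j, j \in agents g' `\ i -> at_ sigma g' j = at_ sigma g j.

End HighwayProblems.

Arguments highway : clear implicits.
Arguments HE : clear implicits.
Arguments solution : clear implicits.

(* Main.v *)
(** The Owen value of a union is its Shapley value in the game between unions,
    so by linearity each section [t] is split equally among the [m_t] unions
    using it: the sum of the Shapley-Tijs value over [P_a] is the [share]
    [\sum_(t in T(P_a)) C(t) / m_t], and within [P_a] its part coming from
    shared sections is divided in proportion to [c^s]. The five properties are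
    read off this formula.

    Conversely, (PO), (ETPU) and (CIOC) force the sum over every union to be its
    share, by induction on the number of sections: (CIOC) restricts the problem
    to the sections of the union, and if all sections are used, (PO) determines
    the common value of the unions using everything. (CPEA) then removes the
    exclusive sections one at a time, and (PSSA) settles what remains. *)

Require Import Defs.
From mathcomp Require Import all_boot all_order all_algebra finmap reals.
From mathcomp Require Import ring.

Set Implicit Arguments.
Unset Strict Implicit.
Unset Printing Implicit Defensive.

Import Order.TTheory GRing.Theory Num.Theory.

Local Open Scope fset_scope.
Local Open Scope ring_scope.

(** * The Shapley value on finite sets *)

Section FsetSums.
Context {I : choiceType} {M : nmodType}.
Implicit Types (A B : {fset I}) (F : I -> M).

Lemma big_fsub_cond A B F : A `<=` B ->
  \sum_(x <- A) F x = \sum_(x <- B | x \in A) F x.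
Proof.
move=> /fsubsetP AB; apply: eq_fbigl_cond => x; rewrite !inE andbT.
by apply/idP/andP => [xA|[]//]; split=> //; apply: AB.
Qed.

Lemma big_fsetI A B F : \sum_(x <- A `&` B) F x = \sum_(x <- A | x \in B) F x.
Proof. by rewrite [RHS]big_fset_condE; apply: eq_fbigl => x; rewrite !inE. Qed.

Lemma sum_fset_const A (x : M) : \sum_(i <- A) x = x *+ #|` A|.
Proof. by rewrite big_const_seq count_predT iter_addr_0. Qed.

Lemma sum_fset_delta A a F : a \in A ->
  \sum_(x <- A) F x *+ (x == a) = F a.
Proof.
move=> aA; rewrite (big_fsetD1 a)//= eqxx mulr1n big1_fset ?addr0// => x.
by rewrite !inE => /andP[/negPf-> _] _; rewrite mulr0n.
Qed.

Lemma big_fpowersetD1 (N : {fset I}) i (F : {fset I} -> M) :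
  \sum_(S <- fpowerset (N `\ i)) F S
  = \sum_(S <- fpowerset N | i \notin S) F S.
Proof.
apply: eq_fbigl_cond => S; rewrite !inE /= !fpowersetE andbT.
by rewrite fsubsetD1.
Qed.

(** Adding [i] is a bijection from the coalitions avoiding [i] onto those containing it, with
    removal of [i] as inverse. *)
Lemma big_fpowersetU1 (N : {fset I}) i (F : {fset I} -> M) : i \in N ->
  \sum_(S <- fpowerset (N `\ i)) F (i |` S)
  = \sum_(S <- fpowerset N | i \in S) F S.
Proof.
move=> iN; transitivity
    (\sum_(S <- [fset i |` S | S in fpowerset (N `\ i)]) F S).
  rewrite [RHS]big_imfset//= => S S'.
  rewrite !fpowersetE !fsubsetD1 => /andP[_ iS] /andP[_ iS'].
  by move=> /(congr1 (fun X => X `\ i)); rewrite !fsetU1K.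
rewrite [RHS]big_fset_condE; apply: eq_fbigl => S; rewrite !inE /= fpowersetE.
apply/imfsetP/andP => [[S' /=]|[SN iS]].
  rewrite fpowersetE fsubsetD1 => /andP[S'N iS'] ->.
  by rewrite fsubUset fsub1set iN S'N fset1U1.
by exists (S `\ i); rewrite /= ?fpowersetE ?fsetSD// fsetD1K.
Qed.

Lemma exchange_big_fset_cond (J : choiceType) A (B : {fset J})
    (Q : I -> J -> bool) (F : I -> J -> M) :
  \sum_(i <- A) \sum_(j <- B | Q i j) F i j
  = \sum_(j <- B) \sum_(i <- A | Q i j) F i j.
Proof. exact: exchange_big_dep. Qed.

End FsetSums.

(** * Weights and efficiency of the Shapley value *)

Section Shapley.
Context {R : realType} {I : choiceType}.
Implicit Types (v : {fset I} -> R) (N S : {fset I}).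

(** The usual weight [s! (n - s - 1)! / n!], written so that the weight in the Owen value is a
    product of two such weights. *)
Definition shapley v N i : R :=
  \sum_(S <- fpowerset (N `\ i))
    (#|` N| * 'C(#|` N|.-1, #|` S|))%:R^-1 * (v (i |` S) - v S).

Lemma shapley_weight_in n s : (0 < s <= n)%N ->
  (n * 'C(n.-1, s.-1))%:R^-1 *+ s = 'C(n, s)%:R^-1 :> R.
Proof.
case: s => //= s sn; rewrite mul_bin_diag natrM invfM -[LHS]mulr_natr.
by rewrite mulrAC mulVf ?mul1r// pnatr_eq0.
Qed.

Lemma shapley_weight_out n s : (s < n)%N ->
  (n * 'C(n.-1, s))%:R^-1 *+ (n - s) = 'C(n, s)%:R^-1 :> R.
Proof.
move=> sn; rewrite mul_bin_diag mul_bin_left natrM invfM -[LHS]mulr_natr.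
by rewrite mulrAC mulVf ?mul1r// pnatr_eq0 -lt0n subn_gt0.
Qed.

(** This is the coefficient of [v S], with [s] the size of [S], in the sum of all Shapley values: a
    gain from each of the [s] members and a loss from each of the [n - s] others. Both totals are
    [1 / 'C(n, s)], except that there is no gain for [s = 0] and no loss for [s = n]. *)
Lemma shapley_weight n s : (0 < n)%N -> (s <= n)%N ->
  (n * 'C(n.-1, s.-1))%:R^-1 *+ s - (n * 'C(n.-1, s))%:R^-1 *+ (n - s)
  = (s == n)%:R - (s == 0%N)%:R :> R.
Proof.
move=> n0; case: s => [_|s].
  rewrite mulr0n sub0r shapley_weight_out// bin0 invr1.
  by rewrite eq_sym (gtn_eqF n0) sub0r.
rewrite leq_eqVlt => /predU1P[<-|sn].
  by rewrite shapley_weight_in ?leqnn// binn subnn mulr0n invr1 eqxx.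
rewrite shapley_weight_in ?(ltnW sn)// shapley_weight_out//.
by rewrite subrr ltn_eqF// subrr.
Qed.

Lemma shapley_efficient v N : N != fset0 ->
  \sum_(i <- N) shapley v N i = v N - v fset0.
Proof.
move=> N0; set n := #|` N|; pose w k : R := (n * 'C(n.-1, k))%:R^-1.
(* Both terms of the marginal contributions become sums over subsets of [N]. When [S] contains [i],
   the coalition that [i] joins has one element fewer, hence the [.-1]. *)
have -> : \sum_(i <- N) shapley v N i =
    \sum_(i <- N) \sum_(S <- fpowerset N | i \in S) w #|` S|.-1 * v S
    - \sum_(i <- N) \sum_(S <- fpowerset N | i \notin S) w #|` S| * v S.
  rewrite -sumrB; apply: eq_fbigr => i iN _; rewrite -big_fpowersetD1.
  rewrite -(big_fpowersetU1 _ iN) -sumrB; apply: eq_fbigr => S.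
  rewrite fpowersetE fsubsetD1 => /andP[_ iS] _.
  by rewrite mulrBr cardfsU1 iS.
rewrite [X in X - _]exchange_big_fset_cond [X in _ - X]exchange_big_fset_cond.
rewrite -sumrB.
transitivity (\sum_(S <- fpowerset N) (v S *+ (S == N) - v S *+ (S == fset0))).
  apply: eq_fbigr => S; rewrite fpowersetE => SN _.
  rewrite -(big_fsub_cond _ SN) sum_fset_const.
  have -> : \sum_(i <- N | i \notin S) w #|` S| * v S
            = (w #|` S| * v S) *+ (n - #|` S|).
    rewrite -(cardfsDS SN) -sum_fset_const (big_fsub_cond _ (fsubsetDl N S)).
    rewrite big_seq_cond [RHS]big_seq_cond; apply: eq_bigl => i.
    by rewrite !inE; case: (i \in N); rewrite ?andbT ?andbF.
  rewrite -!mulrnAl -mulrBl shapley_weight ?cardfs_gt0 ?fsubset_leq_card//.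
  rewrite mulrBl !mulr_natl cardfs_eq0; congr (v S *+ _ - _).
  have /leqifP := fsubset_leqif_cards SN.
  by case: eqP => [-> _|_ /ltn_eqF->//]; rewrite eqxx.
by rewrite sumrB !sum_fset_delta ?fpowersetE ?fsub0set ?fsubset_refl.
Qed.

End Shapley.

(** * The Owen value of a union *)

Section Partitions.
Context {U : choiceType}.
Implicit Types (P : {fset {fset U}}) (N B : {fset U}).

Lemma block_eq P N B B' i : is_partition P N ->
  B \in P -> B' \in P -> i \in B -> i \in B' -> B = B'.
Proof.
move=> /and3P[_ /trivIfsetP tP _] BP B'P iB iB'.
apply: contraTeq iB' => /(tP _ _ BP B'P) /fdisjointP; exact.
Qed.

Lemma block_neq0 P N B : is_partition P N -> B \in P -> B != fset0.
Proof. by move=> /and3P[P0 _ _] BP; apply: contraNneq P0 => <-. Qed.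

Lemma block_sub P N B : is_partition P N -> B \in P -> B `<=` N.
Proof.
by move=> /and3P[_ _ /eqP<-] BP; exact: (@bigfcup_sup _ _ _ _ predT id).
Qed.

Lemma mem_block P N i : is_partition P N -> i \in N ->
  exists2 B, B \in P & i \in B.
Proof.
move=> /and3P[_ _ /eqP<-] /bigfcupP[B /andP[BP _] iB]; by exists B.
Qed.

Lemma union_ofE P N B i : is_partition P N -> B \in P -> i \in B ->
  union_of P i = B.
Proof.
move=> part BP iB; apply/fsetP => j; apply/bigfcupP/idP => [|jB].
  by case=> B' /andP[B'P iB'] jB'; rewrite (block_eq part BP B'P iB iB').
by exists B; rewrite ?BP.
Qed.

Lemma sum_blocks (M : nmodType) P N (F : U -> M) : is_partition P N ->
  \sum_(i <- N) F i = \sum_(B <- P) \sum_(i <- B) F i.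
Proof. by move=> /and3P[_ tP /eqP<-]; exact: big_trivIfset. Qed.

End Partitions.

(** * Shares of the sections and the Owen value *)

Section Share.
Context {R : realType} {U V : choiceType}.
Implicit Types (g : highway R U V) (P : {fset {fset U}}) (S B : {fset U}).

Lemma TSP g S t :
  reflect (exists2 i, i \in S & t \in T_ g i) (t \in TS g S).
Proof.
apply: (iffP (bigfcupP _ _ _ _)) => [[i /andP[iS _] ti]|[i iS ti]].
  by exists i.
by exists i; rewrite ?iS.
Qed.

Lemma TSS g S S' : S `<=` S' -> TS g S `<=` TS g S'.
Proof.
move=> /fsubsetP SS'; apply/fsubsetP => t /TSP[i iS ti].
by apply/TSP; exists i => //; apply: SS'.
Qed.

Lemma TSU g S S' : TS g (S `|` S') = TS g S `|` TS g S'.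
Proof.
apply/fsetP => t; rewrite inE; apply/TSP/orP => [[i]|].
  by rewrite inE => /orP[iS|iS] ti; [left|right]; apply/TSP; exists i.
by case=> /TSP[i iS ti]; exists i; rewrite // inE iS ?orbT.
Qed.

Lemma TS0 g : TS g fset0 = fset0.
Proof. by rewrite /TS big_seq_fset0. Qed.

Lemma TS_fcoverP g P t :
  reflect (exists2 B, B \in P & t \in TS g B) (t \in TS g (fcover P)).
Proof.
apply: (iffP (TSP _ _ _)).
  case=> i /bigfcupP[B /andP[BP _] iB] ti; by exists B => //; apply/TSP; exists i.
case=> B BP /TSP[i iB ti].
by exists i => //; apply/bigfcupP; exists B; rewrite ?BP.
Qed.

Definition union_users g P (t : V) : {fset {fset U}} :=
  [fset B in P | t \in TS g B].

Definition share g P B : R :=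
  \sum_(t <- TS g B) C_ g t / (#|` union_users g P t|)%:R.

Lemma union_users_gt0 g P B t : B \in P -> t \in TS g B ->
  (0 < #|` union_users g P t|)%N.
Proof.
move=> BP tB; rewrite cardfs_gt0; apply/fset0Pn; exists B.
by rewrite !inE BP.
Qed.

(** An index set [K] common to several coalitions lets cost differences be taken section by section:
    the game is a combination of 0/1 games, each charging one section. *)
Lemma cost_gameE g (K : {fset V}) S : TS g S `<=` K ->
  cost_game g S = \sum_(t <- K) C_ g t * (t \in TS g S)%:R.
Proof.
move=> SK; rewrite /cost_game /CS (big_fsub_cond _ SK) big_mkcond.
by apply: eq_bigr => t _; case: ifP => _; rewrite ?mulr1 ?mulr0.
Qed.

(* The probability that none of the unions preceding [B] in a uniformly random
   order of the unions uses [t]. *)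
Definition free_weight g P B t : R :=
  \sum_(H <- fpowerset (P `\ B))
     (#|` P| * 'C(#|` P|.-1, #|` H|))%:R^-1 * (t \notin TS g (fcover H))%:R.

Lemma fcoverU1 P B : fcover (B |` P) = B `|` fcover P.
Proof.
apply/fsetP => i; rewrite in_fsetU; apply/bigfcupP/orP => [[B']|[iB|]].
- rewrite andbT !inE => /orP[/eqP->|B'P] iB'; [by left|right].
  by apply/bigfcupP; exists B'; rewrite ?B'P.
- by exists B; rewrite // fset1U1.
- by case/bigfcupP=> B' /andP[B'P _] iB'; exists B'; rewrite // !inE B'P orbT.
Qed.

(* The coalitions of other unions avoiding [t] are the same for every user
   of [t]. *)
Lemma free_weight_user g P B t : B \in P -> t \in TS g B ->
  free_weight g P B t = \sum_(H <- fpowerset (P `\` union_users g P t))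
    (#|` P| * 'C(#|` P|.-1, #|` H|))%:R^-1.
Proof.
move=> BP tB.
rewrite /free_weight (eq_bigr (fun H => if t \notin TS g (fcover H) then
  (#|` P| * 'C(#|` P|.-1, #|` H|))%:R^-1 else 0)); last first.
  by move=> H _; case: ifP; rewrite ?mulr1 ?mulr0.
rewrite -big_mkcond; apply: eq_fbigl_cond => H.
rewrite !in_fset !inE /= !fpowersetE andbT.
apply/andP/fsubsetP => [[/fsubsetP HP tH] B' B'H|HP].
  have := HP _ B'H; rewrite !inE => /andP[_ B'P]; rewrite B'P andbT.
  by apply: contraNN tH => tB'; apply/TS_fcoverP; exists B'.
split; last first.
  apply/negP => /TS_fcoverP[B' /HP]; rewrite !inE => /andP[+ B'P].
  by rewrite B'P => /negP.
apply/fsubsetP => B' B'H; have := HP _ B'H; rewrite !inE => /andP[+ B'P].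
by rewrite B'P andbT /= => tB'; apply: contraNneq tB' => ->.
Qed.

(* Efficiency of the Shapley value of the game between unions in which only
   the section [t] is charged. *)
Lemma free_weightE g P B t : B \in P -> t \in TS g B ->
  free_weight g P B t = (#|` union_users g P t|)%:R^-1.
Proof.
move=> BP tB; pose v (H : {fset {fset U}}) : R := (t \in TS g (fcover H))%:R.
have /(shapley_efficient v) : P != fset0 by apply/fset0Pn; exists B.
have -> : v P = 1 by rewrite /v; have -> : t \in TS g (fcover P)
  by apply/TS_fcoverP; exists B.
have -> : v fset0 = 0 by rewrite /v /fcover big_seq_fset0 TS0.
rewrite subr0 => eff; apply: (@mulfI _ (#|` union_users g P t|%:R)).
  by rewrite pnatr_eq0 -lt0n (union_users_gt0 BP).
rewrite mulfV; last by rewrite pnatr_eq0 -lt0n (union_users_gt0 BP).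
rewrite -[RHS]eff mulr_natl -sum_fset_const.
rewrite (big_fsub_cond _ (fset_sub _ _)) big_mkcond; apply: eq_fbigr => B' B'P _.
(* A union using [t] pays exactly when no union before it uses [t], so its Shapley value is its
   [free_weight], which equals that of [B]. A union not using [t] gets 0. *)
rewrite !inE B'P /=; case: ifPn => tB'.
  rewrite free_weight_user// -(free_weight_user B'P tB').
  apply: eq_bigr => H _; rewrite /v fcoverU1 TSU inE tB' /=.
  by case: (t \in _); rewrite ?subrr ?subr0.
rewrite [RHS]big1// => H _; rewrite /v fcoverU1 TSU inE (negPf tB') /=.
by rewrite subrr mulr0.
Qed.

(** For a single section the marginal contribution is a product: the indicator that the preceding
    unions avoid [t], times the marginal contribution inside [B] in the game charging only [t]. The
    double sum therefore factors, and efficiency of the inner Shapley value sums it over [B]. *)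
Lemma owen_unionE g P N B : is_partition P N -> B \in P ->
  owen_union (cost_game g) P B = share g P B.
Proof.
move=> part BP; set K := TS g N.
have BN := block_sub part BP.
pose v t (S : {fset U}) : R := (t \in TS g S)%:R.
have owenE i : i \in B -> owen (cost_game g) P i
    = \sum_(t <- K) C_ g t * (free_weight g P B t * shapley (v t) B i).
  move=> iB; rewrite /owen (union_ofE part BP iB).
  transitivity (\sum_(H <- fpowerset (P `\ B)) \sum_(S <- fpowerset (B `\ i))
    \sum_(t <- K) C_ g t * (((#|` P| * 'C(#|` P|.-1, #|` H|))%:R^-1
       * (t \notin TS g (fcover H))%:R)
      * ((#|` B| * 'C(#|` B|.-1, #|` S|))%:R^-1 * (v t (i |` S) - v t S)))).
    apply: eq_fbigr => H; rewrite fpowersetE => HP _.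
    apply: eq_fbigr => S; rewrite fpowersetE => SB _.
    have HN : fcover H `<=` N.
      have /and3P[_ _ /eqP<-] := part; apply/bigfcupsP => B' B'H _.
      apply: (@bigfcup_sup _ _ _ _ predT id) => //.
      by have := fsubsetP HP _ B'H; rewrite !inE => /andP[].
    have SN : S `<=` N.
      by apply: fsubset_trans SB (fsubset_trans _ BN); rewrite fsubD1set.
    have iN : [fset i] `<=` N by rewrite fsub1set (fsubsetP BN).
    rewrite !(@cost_gameE g K) ?TSS ?fsubUset ?HN ?SN//.
    rewrite -sumrB mulr_sumr; apply: eq_bigr => t _.
    rewrite /v [i |` S]fsetUC !TSU !inE !natrM !invfM.
    (* The factorization is checked for each answer to whether the unions of [H], the set [S] and
       the agent [i] use [t]. *)
    by do !case: (t \in _) => /=; ring.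
  under eq_bigr do rewrite exchange_big.
  rewrite exchange_big/=.
  apply: eq_bigr => t _; rewrite /free_weight /shapley big_distrlr/= mulr_sumr.
  by apply: eq_bigr => H _; rewrite mulr_sumr.
rewrite /owen_union (eq_fbigr _ (fun i iB _ => owenE i iB)) exchange_big/=.
rewrite /share (big_fsub_cond _ (TSS _ BN)) [RHS]big_mkcond; apply: eq_bigr => t _.
rewrite -!mulr_sumr shapley_efficient ?(block_neq0 part BP)//.
rewrite /v TS0 in_fset0 subr0; case: ifPn => tB; last by rewrite !mulr0.
by rewrite mulr1 free_weightE.
Qed.

(** After the sums are exchanged, [t] is charged [m_t] times at [C(t) / m_t], and [m_t] is positive
    because some union uses [t]. *)
Lemma sum_share g P N : is_partition P N ->
  \sum_(B <- P) share g P B = CS g (TS g N).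
Proof.
move=> part; rewrite (eq_fbigr _ (fun B BP _ =>
  big_fsub_cond _ (TSS g (block_sub part BP)))) exchange_big_fset_cond.
apply: eq_fbigr => t tN _; rewrite big_fset_condE sum_fset_const.
rewrite -[LHS]mulr_natr -mulrA mulVf ?mulr1// pnatr_eq0 -lt0n.
have /and3P[_ _ /eqP PN] := part; move: tN; rewrite -PN.
by case/TS_fcoverP=> B BP; exact: union_users_gt0.
Qed.

End Share.

(** * Restriction *)

Section Restriction.
Context {R : realType} {U V : choiceType}.
Implicit Types (g : highway R U V) (P : {fset {fset U}}) (S B : {fset U}).
Implicit Types (K : {fset V}).

Lemma T_notin g i : highway_wf g -> i \notin agents g -> T_ g i = fset0.
Proof.
by case/and5P=> _ _ _ /eqP<- _ iN; rewrite /T_ not_fnd.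
Qed.

Lemma T_sub g i : highway_wf g -> T_ g i `<=` secset g.
Proof.
move=> gwf; have [iN|iN] := boolP (i \in agents g); last first.
  by rewrite T_notin// fsub0set.
by case/and5P: gwf => _ _ _ _ /and3P[_ /allP/(_ _ iN)/andP[]].
Qed.

Lemma T_neq0 g i : highway_wf g -> i \in agents g -> T_ g i != fset0.
Proof.
by case/and5P=> _ _ _ _ /and3P[_ /allP iP _] /iP/andP[].
Qed.

Lemma TS_agents g : highway_wf g -> TS g (agents g) = secset g.
Proof. by case/and5P=> _ _ _ _ /and3P[_ _ /eqP]. Qed.

Lemma TS_sub g S : highway_wf g -> TS g S `<=` secset g.
Proof. by move=> gwf; apply/bigfcupsP => i _ _; exact: T_sub. Qed.

Lemma C_ge0 g t : highway_wf g -> 0 <= C_ g t.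
Proof.
case/and5P=> _ _ /eqP domC _ /and3P[/allP Cge0 _ _].
have [/Cge0//|tN] := boolP (t \in secset g).
by rewrite -domC in tN; rewrite /C_ not_fnd.
Qed.

Lemma in_restr_agents g K i :
  (i \in restr_agents g K) = (i \in agents g) && (T_ g i `&` K != fset0).
Proof. by rewrite !inE. Qed.

Lemma secset_restr g K : secset (restr g K) = secset g `&` K.
Proof. by apply/fsetP => t; rewrite !inE /= mem_filter andbC. Qed.

Lemma C_restr g K t : C_ (restr g K) t = if t \in K then C_ g t else 0.
Proof. by rewrite /C_ /= fnd_restrict; case: ifP. Qed.

Lemma usage_restr g K i : (usage (restr g K)).[? i]%fmap
  = if i \in restr_agents g K then Some (T_ g i `&` K) else None.
Proof.
by case: fndP => //= iN; rewrite ffunE.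
Qed.

(** An agent lost by restriction uses no section of [K], and the default value of [T_] is empty too,
    so the formula covers every [i]. *)
Lemma T_restr g K i : highway_wf g -> T_ (restr g K) i = T_ g i `&` K.
Proof.
move=> gwf; rewrite [LHS]/T_ usage_restr in_restr_agents.
case: (boolP (i \in agents g)) => [_|/T_notin->//] /=; last by rewrite fset0I.
by case: eqVneq => [->|].
Qed.

Lemma TS_restr g K S : highway_wf g -> TS (restr g K) S = TS g S `&` K.
Proof.
move=> gwf; apply/fsetP => t; rewrite inE; apply/TSP/andP => [[i iS]|].
  by rewrite T_restr// inE => /andP[ti ->]; split=> //; apply/TSP; exists i.
by case=> /TSP[i iS ti] tK; exists i; rewrite // T_restr// inE ti.
Qed.

Lemma users_restr g K t : highway_wf g -> t \in K ->
  users (restr g K) t = users g t.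
Proof.
move=> gwf tK; apply/fsetP => i; rewrite !inE /= T_restr// inE.
rewrite tK andbT -andbA; case: (i \in agents g) => //=.
apply/andb_idl => ti; apply/fset0Pn; exists t; by rewrite inE ti.
Qed.

Lemma excl_secs_restr g K : highway_wf g ->
  excl_secs (restr g K) = excl_secs g `&` K.
Proof.
move=> gwf; apply/fsetP => t; rewrite !in_fset !inE /= mem_filter.
by have [tK|] := boolP (t \in K); rewrite /= ?andbF// users_restr// andbT.
Qed.

Lemma shared_secs_restr g K : highway_wf g ->
  shared_secs (restr g K) = shared_secs g `&` K.
Proof.
move=> gwf; rewrite /shared_secs excl_secs_restr// secset_restr.
by apply/fsetP => t; rewrite !inE; case: (t \in K); rewrite ?andbT ?andbF.
Qed.

Lemma restr_wf g K : highway_wf g -> K `<=` secset g -> K != fset0 ->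
  highway_wf (restr g K).
Proof.
move=> gwf Kg K0; have /and5P[uq _ /eqP domC domT _] := gwf.
have gK : secset (restr g K) = K by rewrite secset_restr; apply/fsetIidPr.
apply/and5P; split; first by rewrite filter_uniq.
- apply: contraNneq K0 => e; rewrite -gK /secset e.
  by apply/eqP/fsetP => t; rewrite !inE.
- by rewrite domf_restrict domC secset_restr fsetIC.
- by [].
apply/and3P; split.
- by apply/allP => t _; rewrite C_restr; case: ifP => // _; exact: C_ge0.
- apply/allP => i /=; rewrite in_restr_agents => /andP[_ iK].
  by rewrite T_restr// iK gK fsubsetIr.
rewrite TS_restr// gK eqEfsubset fsubsetIr; apply/fsubsetP => t tK.
have := fsubsetP Kg _ tK; rewrite -TS_agents// in_fsetI tK andbT.
move=> /TSP[i iN ti]; apply/TSP; exists i => //.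
by rewrite in_restr_agents iN; apply/fset0Pn; exists t; rewrite inE ti.
Qed.

Lemma TS_restr_agents g K S : highway_wf g ->
  TS g (S `&` restr_agents g K) `&` K = TS g S `&` K.
Proof.
move=> gwf; apply/eqP; rewrite eqEfsubset fsetSI ?TSS ?fsubsetIl//=.
apply/fsubsetP => t; rewrite !inE => /andP[/TSP[i iS ti] tK].
rewrite tK andbT; apply/TSP; exists i => //; rewrite inE iS in_restr_agents /=.
apply/andP; split; last by apply/fset0Pn; exists t; rewrite inE ti.
by apply: contraTT ti => /T_notin->.
Qed.

Lemma restr_unionsP g P K B :
  reflect (exists2 B', B' \in P /\ TS g B' `&` K != fset0
                     & B = B' `&` restr_agents g K)
          (B \in restr_unions g P K).
Proof.
apply: (iffP (imfsetP _ _ _ _)) => [[B' /=]|[B' [B'P B'K] ->]].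
  by rewrite inE => /andP[B'P B'K] ->; exists B'.
by exists B' => //=; rewrite inE B'P.
Qed.

Lemma restr_neq0 g K B : highway_wf g ->
  TS g B `&` K != fset0 -> B `&` restr_agents g K != fset0.
Proof.
move=> gwf; apply: contraNneq => BK.
by rewrite -TS_restr_agents// BK TS0 fset0I.
Qed.

Lemma restr_partition g P K : highway_wf g -> is_partition P (agents g) ->
  is_partition (restr_unions g P K) (restr_agents g K).
Proof.
move=> gwf part; apply/and3P; split.
- apply/restr_unionsP => -[B [BP BK] /esym/eqP].
  by apply/negP; exact: restr_neq0.
- apply/trivIfsetP => _ _ /restr_unionsP[B [BP _] ->]
    /restr_unionsP[B' [B'P _] ->].
  have [->|BB'] := eqVneq B B'; first by rewrite eqxx.
  move=> _; apply/fdisjointP => i; rewrite !inE => /andP[iB _].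
  by apply: contra BB' => /andP[iB' _]; rewrite (block_eq part BP B'P iB iB').
apply/eqP/fsetP => i; apply/bigfcupP/idP => [[B]|].
  by rewrite andbT => /restr_unionsP[B' _ ->]; rewrite inE => /andP[].
move=> iK; have := iK; rewrite in_restr_agents => /andP[iN /fset0Pn[t]].
rewrite inE => /andP[ti tK]; have [B BP iB] := mem_block part iN.
exists (B `&` restr_agents g K); last by rewrite in_fsetI iB.
rewrite andbT; apply/restr_unionsP; exists B => //; split=> //.
by apply/fset0Pn; exists t; rewrite inE tK andbT; apply/TSP; exists i.
Qed.

(** Cutting unions down to the remaining agents is injective on those using [t]: such a trace is
    nonempty, and a common agent identifies the union. Hence [m_t] survives restriction. *)
Lemma card_union_users_restr g P K t : highway_wf g ->
  is_partition P (agents g) -> t \in K ->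
  #|` union_users (restr g K) (restr_unions g P K) t| = #|` union_users g P t|.
Proof.
move=> gwf part tK; pose f B := B `&` restr_agents g K.
have -> : union_users (restr g K) (restr_unions g P K) t
          = [fset f B | B in union_users g P t].
  apply/fsetP => B; rewrite !inE TS_restr//; apply/andP/imfsetP => /=.
    case=> /restr_unionsP[B' [B'P _] ->] tB; exists B' => //.
    by move: tB; rewrite TS_restr_agents// !inE B'P => /andP[].
  case=> B'; rewrite !inE => /andP[B'P tB'] ->.
  rewrite -in_fsetI TS_restr_agents// in_fsetI tB' tK; split=> //.
  apply/restr_unionsP; exists B' => //; split=> //.
  by apply/fset0Pn; exists t; rewrite inE tB'.
rewrite card_in_imfset//= => B B'; rewrite !inE => /andP[BP tB] /andP[B'P tB'].
have /fset0Pn[i] : f B != fset0.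
  by apply: restr_neq0 => //; apply/fset0Pn; exists t; rewrite inE tB.
move=> iB fBB'; have iB' : i \in f B' by rewrite -fBB'.
move: iB iB'; rewrite !in_fsetI => /andP[+ _] /andP[+ _].
exact: block_eq part _ _.
Qed.

Lemma share_restr g P K B : highway_wf g -> is_partition P (agents g) ->
  share (restr g K) (restr_unions g P K) (B `&` restr_agents g K)
  = \sum_(t <- TS g B `&` K) C_ g t / (#|` union_users g P t|)%:R.
Proof.
move=> gwf part; rewrite /share TS_restr// TS_restr_agents//.
apply: eq_fbigr => t; rewrite inE => /andP[_ tK] _.
by rewrite C_restr tK card_union_users_restr.
Qed.

Lemma restr_block g P B : highway_wf g -> is_partition P (agents g) ->
  B \in P -> B `&` restr_agents g (TS g B) = B.
Proof.
move=> gwf part BP; apply/fsetIidPl/fsubsetP => i iB.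
have iN := fsubsetP (block_sub part BP) _ iB.
rewrite in_restr_agents iN; have /fset0Pn[t ti] := T_neq0 gwf iN.
by apply/fset0Pn; exists t; rewrite inE ti; apply/TSP; exists i.
Qed.

(** The share of [B] involves only its own sections and their [m_t], all kept by this restriction;
    this is what gives (CIOC). *)
Lemma share_restr_block g P B : highway_wf g -> is_partition P (agents g) ->
  B \in P ->
  share (restr g (TS g B)) (restr_unions g P (TS g B)) B = share g P B.
Proof.
move=> gwf part BP; have := share_restr (TS g B) B gwf part.
by rewrite (restr_block gwf part BP) fsetIid.
Qed.

Lemma mem_restr_block g P B : highway_wf g -> is_partition P (agents g) ->
  B \in P -> B \in restr_unions g P (TS g B).
Proof.
move=> gwf part BP; apply/restr_unionsP; exists B; last first.
  by rewrite (restr_block gwf part).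
split=> //; rewrite fsetIid; have /fset0Pn[i iB] := block_neq0 part BP.
have /fset0Pn[t ti] := T_neq0 gwf (fsubsetP (block_sub part BP) _ iB).
by apply/fset0Pn; exists t; apply/TSP; exists i.
Qed.

Lemma restr_agents_idem g K : highway_wf g ->
  restr_agents (restr g K) K = restr_agents g K.
Proof.
move=> gwf; apply/fsetP => i; rewrite in_restr_agents /= T_restr//.
by rewrite -fsetIA fsetIid in_restr_agents -andbA andbb.
Qed.

(** Together with [restr_unions_idem], this supplies the hypotheses of (CIOC) for comparing a
    problem with its own restriction to the sections of a union. *)
Lemma restr_idem g K : highway_wf g -> restr (restr g K) K = restr g K.
Proof.
move=> gwf; have raE := restr_agents_idem K gwf.
rewrite [LHS]/restr raE /restr /=; congr Highway.
- by rewrite -filter_predI; apply: eq_filter => t /=; rewrite andbb.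
- by rewrite restrictf_comp fsetIid.
apply/fmapP => i; have := usage_restr g K i; rewrite /= => ->.
case: fndP => //= iN.
by rewrite ffunE T_restr//= -fsetIA fsetIid.
Qed.

Lemma restr_unions_idem g P K : highway_wf g ->
  restr_unions (restr g K) (restr_unions g P K) K = restr_unions g P K.
Proof.
move=> gwf; have raE := restr_agents_idem K gwf.
apply/fsetP => B; apply/restr_unionsP/restr_unionsP.
  case=> _ [/restr_unionsP[B' [B'P B'K] ->] _] ->; exists B' => //.
  by rewrite raE -fsetIA fsetIid.
case=> B' [B'P B'K] ->; exists (B' `&` restr_agents g K).
  split; first by apply/restr_unionsP; exists B'.
  by rewrite TS_restr// TS_restr_agents// -fsetIA fsetIid.
by rewrite raE -fsetIA fsetIid.
Qed.

End Restriction.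

(** * The five properties *)

Section UnionSums.
Context {R : realType} {U V : choiceType}.
Implicit Types (g : highway R U V) (P : {fset {fset U}}) (S B : {fset U}).

Lemma mem_excl_secs g t :
  (t \in excl_secs g) = (t \in secset g) && (#|` users g t| == 1%N).
Proof. by rewrite in_fset inE. Qed.

Lemma excl_secsP g t : highway_wf g -> t \in excl_secs g ->
  exists2 j, j \in agents g & forall i, (t \in T_ g i) = (i == j).
Proof.
move=> gwf; rewrite !inE => /andP[_ /cardfs1P[j jt]].
have : j \in users g t by rewrite jt fset11.
rewrite !inE => /andP[jN tj]; exists j => // i.
have [iN|iN] := boolP (i \in agents g); last first.
  by rewrite T_notin// in_fset0; apply/esym/negbTE; apply: contraNneq iN => ->.
by have /fsetP/(_ i) := jt; rewrite !inE iN.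
Qed.

Definition shared_share g P B : R :=
  \sum_(t <- TS g B `&` shared_secs g) C_ g t / (#|` union_users g P t|)%:R.

(** An exclusive section is used by one agent, hence by one union: [m_t = 1], and its whole cost is
    part of the exclusive cost of that agent. *)
Lemma shareE g P B : highway_wf g -> is_partition P (agents g) -> B \in P ->
  share g P B = ceS g B + shared_share g P B.
Proof.
move=> gwf part BP; rewrite /share (bigID (mem (excl_secs g)))/=; congr (_ + _).
  rewrite -big_fsetI fsetIC big_fsetI /ceS /ce /CS.
  under [RHS]eq_bigr do rewrite /Te fsetIC big_fsetI.
  rewrite exchange_big_fset_cond big_mkcond; apply: eq_fbigr => t tE _.
  have [j jN tT] := excl_secsP gwf tE.
  rewrite (eq_bigl (fun i => i == j)) => [|i]; last by rewrite tT.
  have tB B' : (t \in TS g B') = (j \in B').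
    apply/TSP/idP => [[i iB]|jB]; first by rewrite tT => /eqP<-.
    by exists j; rewrite // tT.
  rewrite tB big_mkcond; case: ifPn => jB; last first.
    rewrite big1_fset// => i iB _; case: eqP => // ij.
    by rewrite -ij iB in jB.
  have -> : union_users g P t = [fset B].
    apply/fsetP => B'; rewrite !inE tB; apply/andP/eqP => [[B'P jB']|->//].
    exact: block_eq part _ _ jB' jB.
  rewrite cardfs1 divr1 (big_fsetD1 j)//= eqxx big1_fset ?addr0// => i.
  by rewrite !inE => /andP[/negPf->].
rewrite /shared_share big_fsetI [RHS]big_seq_cond [LHS]big_seq_cond.
apply: eq_bigl => t; case: (boolP (t \in TS g B)) => //= tB.
by rewrite in_fsetD (fsubsetP (TS_sub _ gwf) _ tB) andbT.
Qed.

Lemma cs_ge0 g i : highway_wf g -> 0 <= cs g i.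
Proof. by move=> gwf; apply: sumr_ge0 => t _; exact: C_ge0. Qed.

Lemma shared_share_ge0 g P B : highway_wf g -> 0 <= shared_share g P B.
Proof.
by move=> gwf; apply: sumr_ge0 => t _; rewrite divr_ge0 ?C_ge0 ?ler0n.
Qed.

Lemma sum_cs_eq0 g B i : highway_wf g -> \sum_(j <- B) cs g j = 0 ->
  i \in B -> cs g i = 0.
Proof.
move=> gwf /eqP; rewrite psumr_eq0; last by move=> j _; exact: cs_ge0.
by move=> /allP csB /csB/eqP.
Qed.

(** This covers the case [0 / 0]: costs are nonnegative, so a vanishing sum makes every shared
    section of [B] free. *)
Lemma shared_share_eq0 g P B : highway_wf g -> \sum_(j <- B) cs g j = 0 ->
  shared_share g P B = 0.
Proof.
move=> gwf cs0; apply: big1_fset => t.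
rewrite inE => /andP[/TSP[i iB ti] tS] _.
have /eqP := sum_cs_eq0 gwf cs0 iB.
rewrite /cs /CS psumr_eq0; last by move=> u _; exact: C_ge0.
by move=> /allP/(_ t); rewrite inE ti tS => /(_ isT)/eqP->; rewrite mul0r.
Qed.

(** The two cases of the definition merge, since [shared_share] is an empty sum when no section is
    shared. *)
Lemma shapley_tijs_atE (g : HE R U V) B i : B \in unions g -> i \in B ->
  shapley_tijs_at g i = ce g i + shared_share g (unions g) B
                        * (cs g i / \sum_(j <- B) cs g j).
Proof.
move=> BP iB; have gwf := problem_wf g; have part := unions_wf g.
rewrite /shapley_tijs_at (union_ofE part BP iB); case: eqP => [gS|_].
  by rewrite /shared_share gS fsetI0 big_seq_fset0 mul0r addr0.
by rewrite (owen_unionE _ part BP) (shareE gwf part BP) [ceS _ _ + _]addrC addrK.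
Qed.

Lemma at_in (sigma : solution R U V) (g : HE R U V) i (iN : i \in agents g) :
  at_ sigma g i = sigma g [` iN].
Proof. by rewrite /at_ insubT. Qed.

Lemma at_notin (sigma : solution R U V) (g : HE R U V) i :
  i \notin agents g -> at_ sigma g i = 0.
Proof. by move=> iN; rewrite /at_ insubN. Qed.

Lemma at_shapley_tijs (g : HE R U V) B i : B \in unions g -> i \in B ->
  at_ (@shapley_tijs R U V) g i = ce g i + shared_share g (unions g) B
                        * (cs g i / \sum_(j <- B) cs g j).
Proof.
move=> BP iB; have iN := fsubsetP (block_sub (unions_wf g) BP) _ iB.
by rewrite at_in ffunE (shapley_tijs_atE BP iB).
Qed.

(** The proportions within [B] add up to 1 unless all [cs] vanish there, and then the shared part to
    be divided is 0. *)
Lemma sum_shapley_tijs (g : HE R U V) B : B \in unions g ->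
  \sum_(i <- B) at_ (@shapley_tijs R U V) g i = share g (unions g) B.
Proof.
move=> BP; have gwf := problem_wf g; have part := unions_wf g.
rewrite (eq_fbigr _ (fun i iB _ => at_shapley_tijs BP iB)) big_split/=.
rewrite -mulr_sumr -mulr_suml (shareE gwf part BP); congr (_ + _).
have [cs0|cs0] := eqVneq (\sum_(j <- B) cs g j) 0.
  by rewrite (shared_share_eq0 _ gwf cs0) mul0r.
by rewrite mulfV// mulr1.
Qed.

Lemma shapley_tijs_PO : PO (@shapley_tijs R U V).
Proof.
move=> g; rewrite (sum_blocks _ (unions_wf g)).
rewrite (eq_fbigr _ (fun B BP _ => sum_shapley_tijs BP)).
by rewrite (sum_share _ (unions_wf g)) TS_agents// problem_wf.
Qed.

Lemma share_eq_TS g P B B' : TS g B = TS g B' -> share g P B = share g P B'.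
Proof. by move=> TSB; rewrite /share TSB. Qed.

Lemma shapley_tijs_ETPU : ETPU (@shapley_tijs R U V).
Proof.
by move=> g B B' BP B'P TSB; rewrite !sum_shapley_tijs//; exact: share_eq_TS.
Qed.

Lemma shapley_tijs_CIOC : CIOC (@shapley_tijs R U V).
Proof.
move=> g g' B BP BP' gg' PP'; rewrite !sum_shapley_tijs//.
rewrite -(share_restr_block (problem_wf g) (unions_wf g) BP) gg' PP'.
exact: share_restr_block (problem_wf g') (unions_wf g') BP'.
Qed.

Lemma ce_eq0 g B i : TeS g B = fset0 -> i \in B -> ce g i = 0.
Proof.
move=> BE iB; rewrite /ce /CS; have -> : Te g i = fset0.
  by apply/eqP; rewrite -fsubset0 -BE (bigfcup_sup (Te g)).
by rewrite big_seq_fset0.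
Qed.

Lemma shapley_tijs_PSSA : PSSA (@shapley_tijs R U V).
Proof.
move=> g B BP BE.
(* The shared part of the share of [B], per unit of [cs]; exclusive costs vanish on [B]. *)
exists (shared_share g (unions g) B / \sum_(j <- B) cs g j).
  rewrite divr_ge0 ?shared_share_ge0 ?problem_wf// sumr_ge0// => i _.
  by rewrite cs_ge0// problem_wf.
move=> i iB; rewrite (at_shapley_tijs BP iB) (ce_eq0 BE iB) add0r.
by rewrite mulrA mulrAC.
Qed.

(* Removing an exclusive section changes nothing but the exclusive cost of its
   unique user. *)
Section Remove.
Context {g' : highway R U V} {P' : {fset {fset U}}} {K : {fset V}} {t : V}.
Context (gwf : highway_wf g') (part : is_partition P' (agents g')).
Context (tK : t \notin K) (gK : secset g' = t |` K).
Context (tE : t \in excl_secs g').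

Let g := restr g' K.

Lemma remove_shared : shared_secs g = shared_secs g'.
Proof.
rewrite shared_secs_restr//; apply/fsetIidPl/fsubsetP => u.
rewrite in_fsetD gK !in_fset1U => /andP[uE /orP[/eqP ut|//]].
by rewrite ut tE in uE.
Qed.

Lemma shared_secs_sub : {subset shared_secs g' <= K}.
Proof.
by move=> u; rewrite -remove_shared shared_secs_restr// in_fsetI => /andP[].
Qed.

Lemma fsetI_shared (X : {fset V}) :
  X `&` K `&` shared_secs g' = X `&` shared_secs g'.
Proof.
rewrite -fsetIA; congr (_ `&` _); apply/fsetIidPr/fsubsetP.
exact: shared_secs_sub.
Qed.

Lemma remove_Ts i : Ts g i = Ts g' i.
Proof. by rewrite /Ts remove_shared T_restr// fsetI_shared. Qed.

Lemma remove_cs i : cs g i = cs g' i.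
Proof.
rewrite /cs remove_Ts; apply: eq_fbigr => u; rewrite inE => /andP[_ uS] _.
by rewrite C_restr (shared_secs_sub uS).
Qed.

Lemma remove_shared_share B :
  shared_share g (restr_unions g' P' K) (B `&` restr_agents g' K)
  = shared_share g' P' B.
Proof.
rewrite /shared_share TS_restr// remove_shared TS_restr_agents// fsetI_shared.
apply: eq_fbigr => u; rewrite inE => /andP[_ /shared_secs_sub uK] _.
by rewrite C_restr uK card_union_users_restr.
Qed.

(** The dropped agents use no section of [K], hence no shared one, and contribute 0. *)
Lemma remove_sum_cs B :
  \sum_(j <- B `&` restr_agents g' K) cs g j = \sum_(j <- B) cs g' j.
Proof.
rewrite (eq_bigr _ (fun i _ => remove_cs i)).
apply: big_fset_incl (fsubsetIl _ _) _ => i iB; rewrite inE iB /=.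
rewrite in_restr_agents; have [_/= iK|iN _] := boolP (i \in agents g').
  rewrite /cs /Ts; suff -> : T_ g' i `&` shared_secs g' = fset0.
    by rewrite /CS big_seq_fset0.
  apply/eqP; rewrite -fsubset0; move: iK; rewrite negbK => /eqP<-.
  by apply/fsetIS/fsubsetP; exact: shared_secs_sub.
by rewrite /cs /Ts T_notin// fset0I /CS big_seq_fset0.
Qed.

Lemma remove_ce i : ce g' i = ce g i + C_ g' t *+ (t \in T_ g' i).
Proof.
have ceE : ce g i = \sum_(u <- Te g' i `\ t) C_ g' u.
  have TeE : Te g i = Te g' i `\ t.
    rewrite /Te T_restr// excl_secs_restr//; apply/fsetP => u.
    rewrite !(in_fsetI, in_fsetD1).
    have [ui|] := boolP (u \in T_ g' i); last by rewrite ?andbF.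
    have := fsubsetP (T_sub i gwf) _ ui; rewrite gK in_fset1U /=.
    case: eqP => [->|_ /= ->]; last by rewrite andbT.
    by rewrite (negPf tK).
  rewrite /ce TeE; apply: eq_fbigr => u uT _; rewrite C_restr.
  move: uT; rewrite in_fsetD1 in_fsetI => /andP[ut /andP[ui _]].
  have := fsubsetP (T_sub i gwf) _ ui; rewrite gK in_fset1U (negPf ut) /=.
  by move=> ->.
have [ti|ti] := boolP (t \in T_ g' i).
  by rewrite ceE /ce /CS (big_fsetD1 t) 1?addrC// in_fsetI ti.
by rewrite ceE mem_fsetD1 ?addr0// in_fsetI (negPf ti).
Qed.

End Remove.

Lemma shapley_tijs_CPEA : CPEA (@shapley_tijs R U V).
Proof.
move=> g g' i t iN' tK gK gE PE tE.
have gwf := problem_wf g'; have part := unions_wf g'.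
have tX : t \in excl_secs g' by rewrite mem_excl_secs gK fset1U1 tE cardfs1.
have agE : agents g = restr_agents g' (secset g) := congr1 (@agents _ _ _) gE.
(* One formula for all agents of [g']; the cost of [t] is added only for its user. *)
have key j : j \in agents g' -> at_ (@shapley_tijs R U V) g' j
    = at_ (@shapley_tijs R U V) g j + C_ g' t *+ (t \in T_ g' j).
  move=> jN'; have [B BP jB] := mem_block part jN'.
  rewrite (at_shapley_tijs BP jB) (remove_ce gwf tK gK tX).
  rewrite -(remove_shared_share gwf part gK tX) -(remove_sum_cs gwf gK tX).
  rewrite -(remove_cs gwf gK tX) addrAC; congr (_ + _).
  rewrite -gE -PE; have [jN|jN] := boolP (j \in agents g).
    rewrite (at_shapley_tijs (B := B `&` agents g))//.
    - by rewrite agE.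
    - rewrite PE; apply/restr_unionsP; exists B; last by rewrite agE.
      split=> //; rewrite agE in_restr_agents in jN.
      have /andP[_ /fset0Pn[u]] := jN; rewrite in_fsetI => /andP[uj uK].
      by apply/fset0Pn; exists u; rewrite in_fsetI uK andbT; apply/TSP; exists j.
    by rewrite in_fsetI jB.
  (* An agent absent from [g] has value 0 there by convention; its costs in [g] are empty sums, so
     the formula gives 0 as well. *)
  have T0 := T_notin (problem_wf g) jN.
  rewrite at_notin// /ce /cs /Te /Ts T0 !fset0I /CS big_seq_fset0.
  by rewrite mul0r mulr0 addr0.
have tT j : j \in agents g' -> (t \in T_ g' j) = (j == i).
  by move=> jN'; have /fsetP/(_ j) := tE; rewrite !inE jN'.
split=> [|j]; first by rewrite key// tT// eqxx.
by rewrite !inE => /andP[ji jN']; rewrite key// tT// (negPf ji) addr0.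
Qed.

End UnionSums.

(** * Uniqueness *)

Section Uniqueness.
Context {R : realType} {U V : choiceType}.
Implicit Types (g : HE R U V) (B : {fset U}) (sigma : solution R U V).

Definition restrHE g K (Kg : K `<=` secset g) (K0 : K != fset0) : HE R U V :=
  MkHE (restr_wf (problem_wf g) Kg K0)
       (restr_partition K (problem_wf g) (unions_wf g)).

Lemma secset_restrHE g K (Kg : K `<=` secset g) (K0 : K != fset0) :
  secset (restrHE Kg K0) = K.
Proof. by rewrite /= secset_restr; apply/fsetIidPr. Qed.

(* The unions using every section have equal sums by (ETPU); the sums of the
   others are known by induction through (CIOC), and (PO) gives the rest. *)
Lemma sum_unionE sigma : PO sigma -> ETPU sigma -> CIOC sigma ->
  forall g B, B \in unions g ->
  \sum_(i <- B) at_ sigma g i = share g (unions g) B.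
Proof.
move=> po etpu cioc g B; have [n] := ubnP #|` secset g|.
elim: n g B => // n IH g B /ltnSE gn BP.
have gwf := problem_wf g; have part := unions_wf g.
(* Restricting to the sections of [B'], which are fewer, changes neither its sum, by (CIOC), nor its
   share. *)
have small B' : B' \in unions g -> TS g B' != secset g ->
    \sum_(i <- B') at_ sigma g i = share g (unions g) B'.
  move=> B'P TB'; have Kg := TS_sub B' gwf.
  have K0 : TS g B' != fset0.
    have /restr_unionsP[B'' [_ +] eB] := mem_restr_block gwf part B'P.
    by apply: contraNneq => ->; rewrite fsetI0.
  rewrite (cioc g (restrHE Kg K0) B')//=.
  - rewrite IH/= ?share_restr_block ?mem_restr_block// secset_restr.
    rewrite (fsetIidPr Kg) (leq_trans _ gn)// fproper_ltn_card//.
    by rewrite fproperEneq TB'.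
  - exact: mem_restr_block.
  - by rewrite TS_restr// fsetIid restr_idem.
  - by rewrite TS_restr// fsetIid restr_unions_idem.
have [TB|] := eqVneq (TS g B) (secset g); last exact: small.
(* The deviation [d] from the claim adds up to 0 by (PO), vanishes on the unions covered by [small],
   and by (ETPU) is constant on the set [m], which contains [B]. *)
pose d B' := \sum_(i <- B') at_ sigma g i - share g (unions g) B'.
have d0 : \sum_(B' <- unions g) d B' = 0.
  by rewrite sumrB -(sum_blocks _ part) po (sum_share _ part) TS_agents// subrr.
pose m := [fset B' in unions g | TS g B' == secset g].
have : d B *+ #|` m| = 0.
  rewrite -sum_fset_const -[RHS]d0 (big_fsub_cond _ (fset_sub _ _)) big_mkcond.
  apply: eq_fbigr => B' B'P _; rewrite !inE B'P /=; case: eqP => [TB'|/eqP TB'].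
    have TBB' : TS g B = TS g B' by rewrite TB.
    by rewrite /d (etpu g B B')// (share_eq_TS _ TBB').
  by rewrite /d small// subrr.
move/eqP; rewrite mulrn_eq0 cardfs_eq0 subr_eq0 => /orP[/eqP/fsetP/(_ B)|/eqP//].
by rewrite !inE BP TB eqxx.
Qed.

(** (PSSA) leaves one unknown constant per union, and the sum given by [sum_unionE] determines it.
    If all [cs] vanish on [B], both sides are 0. *)
Lemma at_no_excl sigma g : PO sigma -> ETPU sigma -> CIOC sigma ->
  PSSA sigma -> excl_secs g = fset0 ->
  forall B i, B \in unions g -> i \in B -> at_ sigma g i =
    share g (unions g) B * (cs g i / \sum_(j <- B) cs g j).
Proof.
move=> po etpu cioc pssa gE B i BP iB.
have BE : TeS g B = fset0.
  by apply/eqP; rewrite -fsubset0; apply/bigfcupsP => j _ _; rewrite /Te gE fsetI0.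
have [k _ sk] := pssa g B BP BE.
have := sum_unionE po etpu cioc BP; rewrite (eq_fbigr _ (fun j jB _ => sk j jB)).
rewrite -mulr_sumr => <-; rewrite sk//.
have [cs0|cs0] := eqVneq (\sum_(j <- B) cs g j) 0.
  by rewrite (sum_cs_eq0 (problem_wf g) cs0 iB) mul0r !mulr0.
by rewrite mulrACA mulfV// mulr1.
Qed.

(** Two solutions are compared by induction on the number of sections, so that (CPEA) only has to
    transfer equality from the problem with one exclusive section removed. *)
Lemma at_unique sigma sigma' :
  PO sigma -> ETPU sigma -> CIOC sigma -> PSSA sigma -> CPEA sigma ->
  PO sigma' -> ETPU sigma' -> CIOC sigma' -> PSSA sigma' -> CPEA sigma' ->
  forall g i, i \in agents g -> at_ sigma g i = at_ sigma' g i.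
Proof.
move=> po etpu cioc pssa cpea po' etpu' cioc' pssa' cpea' g.
have [n] := ubnP #|` secset g|; elim: n g => // n IH g /ltnSE gn i iN.
have gwf := problem_wf g; have part := unions_wf g.
have [gE|/fset0Pn[t tE]] := eqVneq (excl_secs g) fset0.
  have [B BP iB] := mem_block part iN.
  by rewrite (at_no_excl _ _ _ _ gE BP iB)// (at_no_excl _ _ _ _ gE BP iB).
have [j jN tT] := excl_secsP gwf tE.
have tg : t \in secset g by move: tE; rewrite mem_excl_secs => /andP[].
pose K := secset g `\ t; have Kg : K `<=` secset g := fsubD1set _ _.
(* If [t] is the only section, removing it leaves no problem to which (CPEA) could refer. But then
   [j] is the only agent, and (PO) fixes its value. *)
have [K0|K0] := eqVneq K fset0.
  have gt : secset g = [fset t] by rewrite -(fsetD1K tg) -/K K0 fsetU0.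
  have Nj k : k \in agents g -> k = j.
    move=> kN; have /fset0Pn[u uk] := T_neq0 gwf kN.
    have := fsubsetP (T_sub k gwf) _ uk; rewrite gt in_fset1 => /eqP ut.
    by move: uk; rewrite ut tT => /eqP.
  have gj : agents g = [fset j].
    apply/fsetP => k; rewrite in_fset1; apply/idP/eqP => [/Nj//|->//].
  by have := po g; rewrite -(po' g) gj !big_seq_fset1 (Nj i iN).
pose g0 := restrHE Kg K0; have g0K : secset g0 = K := secset_restrHE Kg K0.
have users_t : users g t = [fset j].
  by apply/fsetP => k; rewrite !inE /= tT; apply/andb_idl => /eqP->.
have step s : CPEA s -> at_ s g j = at_ s g0 j + C_ g t
    /\ forall k, k \in agents g `\ j -> at_ s g k = at_ s g0 k.
  by move=> cp; apply: cp; rewrite ?g0K ?fsetD11 ?fsetD1K.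
(* The user of [t] may be absent from [g0]; both solutions then give 0 by the convention in
   [at_]. *)
have IH0 k : at_ sigma g0 k = at_ sigma' g0 k.
  have [kN|kN] := boolP (k \in agents g0); last by rewrite !at_notin.
  by apply: IH => //; rewrite g0K (leq_trans _ gn)// fproper_ltn_card// fproperD1.
have [sj sk] := step _ cpea; have [sj' sk'] := step _ cpea'.
have [->|ij] := eqVneq i j; first by rewrite sj sj' IH0.
by rewrite sk ?sk' ?IH0// in_fsetD1 ij.
Qed.

End Uniqueness.

Theorem theorem3p3 (R : realType) (U V : choiceType) :
  (PO (shapley_tijs : solution R U V)
   /\ ETPU (shapley_tijs : solution R U V)
   /\ CIOC (shapley_tijs : solution R U V)
   /\ PSSA (shapley_tijs : solution R U V)
   /\ CPEA (shapley_tijs : solution R U V))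
  /\ (forall sigma : solution R U V,
        PO sigma -> ETPU sigma -> CIOC sigma -> PSSA sigma -> CPEA sigma ->
        forall g : HE R U V, sigma g = shapley_tijs g).
Proof.
have po := @shapley_tijs_PO R U V; have etpu := @shapley_tijs_ETPU R U V.
have cioc := @shapley_tijs_CIOC R U V; have pssa := @shapley_tijs_PSSA R U V.
have cpea := @shapley_tijs_CPEA R U V.
split=> // sigma po1 etpu1 cioc1 pssa1 cpea1 g; apply/ffunP => -[i iN].
by rewrite -!at_in; apply: at_unique.
Qed.
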